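(* Let $\mathcal{A}(t)$ be a fanning frame of $2n\times n$ matrices and let $\mathbf{K}(t)$ be the Jacobi endomorphism of the fanning curve it spans. The Schwarzian $\{\mathcal{A}(t),t\}$ is characterized by the equation $$\mathbf{K}(t)\mathcal{A}(t)=\tfrac12\,\mathcal{A}(t)\{\mathcal{A}(t),t\},$$ i.e. it is the unique curve of $n\times n$ matrices satisfying this equation for all $t$.
   Context: For $2n\times n$ matrices $\mathcal{A},\mathcal{B}$, $(\mathcal{A}|\mathcal{B})$ is the $2n\times 2n$ matrix obtained by juxtaposition. A fanning frame is a smooth curve $\mathcal{A}(t)$, $t\in\mathbb{R}$, of real $2n\times n$ matrices such that $(\mathcal{A}(t)|\dot{\mathcal{A}}(t))$ is invertible for all $t$. Its fundamental endomorphism $\mathbf{F}(t)$ is the curve of $2n\times 2n$ matrices determined by $\mathbf{F}(t)\mathcal{A}(t)=O$, $\mathbf{F}(t)\dot{\mathcal{A}}(t)=\mathcal{A}(t)$ (it depends only on the curve of column spans, which is called the fanning curve spanned by $\mathcal{A}(t)$). The Jacobi endomorphism is $\mathbf{K}(t)=\ddot{\mathbf{F}}(t)^2/4$. Since the columns of $\mathcal{A}(t),\dot{\mathcal{A}}(t)$ form a basis of $\mathbb{R}^{2n}$, there are unique smooth curves of $n\times n$ matrices $P(t),Q(t)$ with $\ddot{\mathcal{A}}+\dot{\mathcal{A}}P(t)+\mathcal{A}Q(t)=O$; the Schwarzian of $\mathcal{A}(t)$ is $\{\mathcal{A}(t),t\}=2Q(t)-\tfrac12P(t)^2-\dot P(t)$.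 *)

(* Defs.v *)
From mathcomp Require Import all_boot all_order all_algebra.
From mathcomp Require Import all_classical all_reals all_analysis.

Set Implicit Arguments.
Unset Strict Implicit.
Unset Printing Implicit Defensive.

Import Order.TTheory GRing.Theory Num.Theory.
Import numFieldNormedType.Exports.

Local Open Scope ring_scope.

Definition smooth_curve (R : realType) (V : normedModType R) (f : R -> V) : Prop :=
  forall (k : nat) (t : R), derivable (derive1n k f) t 1.

Section Fanning.
Context {R : realType} {n : nat}.
Implicit Types (A : R -> 'M[R]_(n + n, n)) (t : R).

Definition frame_mx A t : 'M[R]_(n + n) := row_mx (A t) (derive1 A t).

Definition fanning_frame A : Prop :=
  smooth_curve A /\ forall t, frame_mx A t \in unitmx.

(* The solution of F A = 0, F A' = A, i.e. of F (A | A') = (0 | A); see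
   [fundamental_endoP]. *)
Definition fundamental_endo A t : 'M[R]_(n + n) :=
  row_mx 0 (A t) *m invmx (frame_mx A t).

Definition jacobi_endo A t : 'M[R]_(n + n) :=
  let ddF := derive1n 2 (fundamental_endo A) t in 4^-1 *: (ddF *m ddF).

(* The solution of A'' + A' P + A Q = 0, i.e. of (A | A') (Q ; P) = - A'';
   see [frame_coefP]. *)
Definition frame_coef A t : 'M[R]_(n + n, n) :=
  - (invmx (frame_mx A t) *m derive1n 2 A t).
Definition frame_P A t : 'M[R]_n := dsubmx (frame_coef A t).
Definition frame_Q A t : 'M[R]_n := usubmx (frame_coef A t).

Definition schwarzian A t : 'M[R]_n :=
  2 *: frame_Q A t - 2^-1 *: (frame_P A t *m frame_P A t) - derive1 (frame_P A) t.

Lemma fundamental_endoP A t (F : 'M[R]_(n + n)) : fanning_frame A ->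
  (F *m A t = 0 /\ F *m derive1 A t = A t) <-> F = fundamental_endo A t.
Proof.
move=> [_ /(_ t) uA]; split => [[FA FdA]|->].
  by rewrite /fundamental_endo -FdA -{1}FA -mul_mx_row mulmxK.
apply: eq_row_mx; rewrite -mul_mx_row -/(frame_mx A t).
by rewrite /fundamental_endo mulmxKV.
Qed.

Lemma frame_coefP A t (P Q : 'M[R]_n) : fanning_frame A ->
  derive1n 2 A t + derive1 A t *m P + A t *m Q = 0
  <-> P = frame_P A t /\ Q = frame_Q A t.
Proof.
move=> [_ /(_ t) uA].
have -> : derive1n 2 A t + derive1 A t *m P + A t *m Q
          = frame_mx A t *m col_mx Q P + derive1n 2 A t.
  by rewrite mul_row_col -addrA addrC [_ *m P + _]addrC.
split => [/eqP|[-> ->]].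
  rewrite addr_eq0 => /eqP E.
  have e : col_mx Q P = frame_coef A t.
    by rewrite /frame_coef -mulmxN -E mulKmx.
  by rewrite /frame_P /frame_Q -e col_mxKd col_mxKu.
by rewrite vsubmxK /frame_coef mulmxN mulKVmx// addNr.
Qed.

End Fanning.

(* Main.v *)
(** Differentiating [F A = 0] and [F A' = A] twice, and eliminating [A''] by
    [A'' = - A' P - A Q], gives the action of [F''] on the basis [(A | A')]:
    [F'' A = - 2 A' - A P] and [F'' A' = A' P + A (P^2 + P' - 2 Q)].
    Hence [F''^2 A = A (4 Q - P^2 - 2 P')].  Uniqueness holds because the
    columns of [A] are linearly independent. *)
Require Import Defs.
From mathcomp Require Import all_boot all_order all_algebra.
From mathcomp Require Import all_classical all_reals all_analysis.
From mathcomp Require Import ring.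
Import Order.TTheory GRing.Theory Num.Theory.
Import numFieldNormedType.Exports.
Local Open Scope ring_scope.

Set Implicit Arguments.
Unset Strict Implicit.
Unset Printing Implicit Defensive.

(** * Differentiability of matrix operations *)

Lemma derivable_bigsum (R : realType) (I : Type) (r : seq I) (P : pred I)
    (F : I -> R -> R) (t : R) :
  (forall i, derivable (F i) t 1) ->
  derivable (fun x => \sum_(i <- r | P i) F i x) t 1.
Proof.
move=> dF; elim: r => [|i r IH].
  by under eq_fun do rewrite big_nil; exact: derivable_cst.
under eq_fun do rewrite big_cons; case: (P i); last exact: IH.
exact: (derivableD (dF i) IH).
Qed.

Lemma derivable_bigprod (R : realType) (I : Type) (r : seq I) (P : pred I)
    (F : I -> R -> R) (t : R) :
  (forall i, derivable (F i) t 1) ->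
  derivable (fun x => \prod_(i <- r | P i) F i x) t 1.
Proof.
move=> dF; elim: r => [|i r IH].
  by under eq_fun do rewrite big_nil; exact: derivable_cst.
under eq_fun do rewrite big_cons; case: (P i); last exact: IH.
exact: (derivableM (dF i) IH).
Qed.

(** The Leibniz formula writes the determinant as a sum of signed products of entries. *)
Lemma derivable_det (R : realType) (n : nat) (M : R -> 'M[R]_n) (t : R) :
  derivable M t 1 -> derivable (fun x => \det (M x)) t 1.
Proof.
move=> /derivable_mxP dM; apply: derivable_bigsum => s.
apply: derivableM; first exact: derivable_cst.
by apply: derivable_bigprod => i; exact: dM.
Qed.

(** By Cramer's rule each entry of the inverse is a cofactor divided by the determinant.
    Invertibility at every [x] makes this an equality of functions, which can then be
    differentiated. *)
Lemma derivable_invmx (R : realType) (n : nat) (M : R -> 'M[R]_n) (t : R) :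
  (forall x, M x \in unitmx) -> derivable M t 1 ->
  derivable (fun x => invmx (M x)) t 1.
Proof.
move=> uM dM; apply/derivable_mxP => i j.
have -> : (fun x => invmx (M x) i j) =
          (fun x => (\det (M x))^-1 * ((-1) ^+ (j + i) * \det (row' j (col' i (M x))))).
  by apply/funext => x; rewrite /invmx uM !mxE.
apply: derivableM.
  apply: derivableV; last exact: derivable_det.
  by rewrite -unitfE -unitmxE.
apply: derivableM; first exact: derivable_cst.
apply/derivable_det/derivable_mxP => k l.
under eq_fun do rewrite !mxE.
by move/derivable_mxP: dM; apply.
Qed.

Lemma derivable_row_mx (R : realType) (m n1 n2 : nat)
    (X : R -> 'M[R]_(m, n1)) (Y : R -> 'M[R]_(m, n2)) (t : R) :
  derivable X t 1 -> derivable Y t 1 ->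
  derivable (fun x => row_mx (X x) (Y x)) t 1.
Proof.
move=> /derivable_mxP dX /derivable_mxP dY; apply/derivable_mxP => i j.
by under eq_fun do rewrite mxE; case: (fintype.split j) => k; [exact: dX|exact: dY].
Qed.

Lemma derivable_dsubmx (R : realType) (m1 m2 n : nat)
    (X : R -> 'M[R]_(m1 + m2, n)) (t : R) :
  derivable X t 1 -> derivable (fun x => dsubmx (X x)) t 1.
Proof.
move=> /derivable_mxP dX; apply/derivable_mxP => i j.
by under eq_fun do rewrite mxE; exact: dX.
Qed.

Lemma derivable_mulmx (R : realType) (m n p : nat)
    (X : R -> 'M[R]_(m, n)) (Y : R -> 'M[R]_(n, p)) (t : R) :
  derivable X t 1 -> derivable Y t 1 ->
  derivable (fun x => X x *m Y x) t 1.
Proof.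
move=> /derivable_mxP dX /derivable_mxP dY; apply/derivable_mxP => i j.
under eq_fun do rewrite mxE.
by apply: derivable_bigsum => k; exact: derivableM.
Qed.

(** * Derivative formulas for matrix curves *)

Lemma derive1_mx (R : realType) (m n : nat) (X : R -> 'M[R]_(m, n)) (t : R) i j :
  derivable X t 1 -> (derive1 X t) i j = derive1 (fun x => X x i j) t.
Proof. by move=> dX; rewrite !derive1E derive_mx// mxE. Qed.

Lemma derive1_row_mx (R : realType) (m n1 n2 : nat)
    (X : R -> 'M[R]_(m, n1)) (Y : R -> 'M[R]_(m, n2)) (t : R) :
  derivable X t 1 -> derivable Y t 1 ->
  derive1 (fun x => row_mx (X x) (Y x)) t = row_mx (derive1 X t) (derive1 Y t).
Proof.
move=> dX dY; apply/matrixP => i j; rewrite derive1_mx; last exact: derivable_row_mx.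
rewrite mxE; under eq_fun do rewrite mxE.
by case: (fintype.split j) => k; rewrite derive1_mx.
Qed.

Lemma derive1_mulmx (R : realType) (m n p : nat)
    (X : R -> 'M[R]_(m, n)) (Y : R -> 'M[R]_(n, p)) (t : R) :
  derivable X t 1 -> derivable Y t 1 ->
  derive1 (fun x => X x *m Y x) t = derive1 X t *m Y t + X t *m derive1 Y t.
Proof.
move=> dX dY; have dXe := (derivable_mxP _ _ _).1 dX.
have dYe := (derivable_mxP _ _ _).1 dY.
apply/matrixP => i j; rewrite derive1_mx; last exact: derivable_mulmx.
rewrite !mxE -big_split/= derive1E.
under eq_fun do rewrite mxE.
have -> : (fun x => \sum_k X x i k * Y x k j) =
          \sum_(k < n) (fun x => X x i k * Y x k j).
  by apply/funext => x; rewrite fct_sumE.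
rewrite derive_sum; last by move=> k; exact: derivableM.
apply: eq_bigr => k _; rewrite !derive1_mx// !derive1E.
rewrite (deriveM (dXe i k) (dYe k j)).
by rewrite addrC /GRing.scale/= [Y t k j * _]mulrC.
Qed.

(** Differentiate the constant curve [M *m invmx M] and cancel [M] on the left. *)
Lemma derive1_invmx (R : realType) (n : nat) (M : R -> 'M[R]_n) (t : R) :
  (forall x, M x \in unitmx) -> derivable M t 1 ->
  derive1 (fun x => invmx (M x)) t = - (invmx (M t) *m derive1 M t *m invmx (M t)).
Proof.
move=> uM dM; have dN := derivable_invmx uM dM.
have := derive1_mulmx dM dN; under eq_fun do rewrite mulmxV//.
rewrite derive1_cst => /esym/eqP; rewrite addrC addr_eq0 => /eqP E.
by rewrite -[LHS](mulKmx (uM t)) E mulmxN mulmxA.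
Qed.

(* [derivable] unfolds to a function type, so the point of differentiation would
   otherwise become implicit. *)
Unset Implicit Arguments.

(** * Action of [F] and its derivatives on the moving frame *)

Section FanningFrame.
Context {R : realType} {n : nat}.
Variable A : R -> 'M[R]_(n + n, n).
Hypothesis fA : fanning_frame A.

Let F := fundamental_endo A.
Let P := frame_P A.
Let Q := frame_Q A.
Let A1 := derive1 A.
Let A2 := derive1 A1.

Let dA t : derivable A t 1. Proof. exact: fA.1 0%N t. Qed.
Let dA1 t : derivable A1 t 1. Proof. exact: fA.1 1%N t. Qed.
Let dA2 t : derivable A2 t 1. Proof. exact: fA.1 2%N t. Qed.

Let uG : forall t, frame_mx A t \in unitmx. Proof. exact: fA.2. Qed.

Let dG t : derivable (frame_mx A) t 1. Proof. exact: derivable_row_mx. Qed.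

Let dN t : derivable (fun x => invmx (frame_mx A x)) t 1.
Proof. exact: derivable_invmx. Qed.

Let dB t : derivable (fun x => row_mx 0 (A x) : 'M[R]_(n + n)) t 1.
Proof. by apply: derivable_row_mx => //; exact: derivable_cst. Qed.

Let dF t : derivable F t 1. Proof. exact: derivable_mulmx. Qed.

Let dG1 t : derivable (derive1 (frame_mx A)) t 1.
Proof.
have -> : derive1 (frame_mx A) = fun x => row_mx (A1 x) (A2 x).
  by apply/funext => x; rewrite derive1_row_mx.
exact: derivable_row_mx.
Qed.

Let dF1 t : derivable (derive1 F) t 1.
Proof.
pose N x := invmx (frame_mx A x).
(* The product rule for [F = (0 | A) N], with [N' = - N G' N] where [G = (A | A')], expresses [F']
   through curves already known to be differentiable. *)
have -> : derive1 F = fun x => row_mx 0 (A1 x) *m N x +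
    row_mx 0 (A x) *m - (N x *m derive1 (frame_mx A) x *m N x).
  apply/funext => x; rewrite (derive1_mulmx (dB x) (dN x)) (derive1_invmx uG (dG x)).
  by rewrite (derive1_row_mx (derivable_cst _ _ _) (dA x)) derive1_cst.
apply: derivableD; apply: derivable_mulmx => //.
  by apply: derivable_row_mx => //; exact: derivable_cst.
by apply: derivableN; do 2 apply: derivable_mulmx => //.
Qed.

Let dP t : derivable P t 1.
Proof. by apply: derivable_dsubmx; apply: derivableN; exact: derivable_mulmx. Qed.

Let A2E t : A2 t = - (A1 t *m P t + A t *m Q t).
Proof.
apply/eqP; rewrite -addr_eq0 addrA; apply/eqP.
exact: (frame_coefP t (P t) (Q t) fA).2 (conj erefl erefl).
Qed.

Let FA t : F t *m A t = 0.
Proof. by have [] := (fundamental_endoP t (F t) fA).2 erefl. Qed.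

Let FA1 t : F t *m A1 t = A t.
Proof. by have [] := (fundamental_endoP t (F t) fA).2 erefl. Qed.

Let F1A t : derive1 F t *m A t = - A t.
Proof.
have := derive1_mulmx (dF t) (dA t); under eq_fun do rewrite FA.
by rewrite derive1_cst FA1 => /esym/eqP; rewrite addr_eq0 => /eqP.
Qed.

(** Differentiating [F A' = A] gives [F' A' + F A'' = A']. Here [F A'' = - A P], since [F] kills
    [A Q] and sends [A' P] to [A P]. *)
Let F1A1 t : derive1 F t *m A1 t = A1 t + A t *m P t.
Proof.
have := derive1_mulmx (dF t) (dA1 t); under eq_fun do rewrite FA1.
rewrite -/A1 -/A2 A2E mulmxN mulmxDr !mulmxA FA1 FA mul0mx addr0.
by move=> /esym/eqP; rewrite subr_eq => /eqP.
Qed.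

Let F2A t : derive1n 2 F t *m A t = - (A1 t *+ 2 + A t *m P t).
Proof.
have := derive1_mulmx (dF1 t) (dA t); under eq_fun do rewrite F1A.
have -> : derive1 (fun x => - A x) t = - A1 t.
  by rewrite /A1 !derive1E; exact: (deriveN (dA t)).
rewrite -/A1 [X in _ + X]F1A1 => /eqP.
rewrite -subr_eq => /eqP <-.
by rewrite mulr2n !opprD !addrA.
Qed.

(** Differentiate [F' A' = A' + A P]. The term [- A Q] arises twice: from [A''] on the right-hand
    side, and from [- F' A''] because [F' A = - A]. *)
Let F2A1 t : derive1n 2 F t *m A1 t =
  A1 t *m P t + A t *m (P t *m P t + derive1 P t - Q t *+ 2).
Proof.
have := derive1_mulmx (dF1 t) (dA1 t); under eq_fun do rewrite F1A1.
have -> : derive1 (fun x => A1 x + A x *m P x) t =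
    A2 t + (A1 t *m P t + A t *m derive1 P t).
  rewrite -(derive1_mulmx (dA t) (dP t)) /A2 !derive1E.
  exact: (deriveD (dA1 t) (derivable_mulmx (dA t) (dP t))).
rewrite -/A1 -/A2 A2E mulmxN => /eqP.
rewrite eq_sym subr_eq => /eqP ->.
rewrite mulr2n !mulmxDr !mulmxN !mulmxDr !mulmxA F1A1 F1A mulmxDl mulNmx.
(* With the matrix products taken as atoms, the identity is linear and can be checked entry by entry
   over [R]. *)
move: (A1 t *m P t) (A t *m Q t) (A t *m P t *m P t) (A t *m derive1 P t) => a b c d.
by apply/matrixP => i j; rewrite !mxE; ring.
Qed.

Lemma jacobi_endo_frame t :
  jacobi_endo A t *m A t = 2^-1 *: (A t *m schwarzian A t).
Proof.
rewrite /jacobi_endo /= -scalemxAl -mulmxA -/F [X in _ *m X]F2A.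
(* Apply [F''] again to [- (2 A' + A P)]. The two [A' P] contributions cancel, so the result lies in
   the column span of [A]; a quarter of [4 Q - P^2 - 2 P'] is half the Schwarzian. *)
rewrite mulr2n mulmxN !mulmxDr mulmxA F2A F2A1 /schwarzian -/P -/Q !mulr2n.
rewrite mulNmx !mulmxDl !(mulmxN, mulmxDr) -!scalemxAr !mulmxA.
move: (A1 t *m P t) (A t *m Q t) (A t *m P t *m P t) (A t *m derive1 P t) => a b c d.
by apply/matrixP => i j; rewrite !mxE; field.
Qed.

(** Padding with a zero block gives [A S = (A | A') (S ; 0)], and the frame matrix is invertible. *)
Lemma frame_mulmx_inj t : injective (mulmx (A t) : 'M[R]_n -> _).
Proof.
move=> S T AST; have : frame_mx A t *m col_mx S 0 = frame_mx A t *m col_mx T 0.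
  by rewrite !mul_row_col !mulmx0 !addr0.
by move/(congr1 (mulmx (invmx (frame_mx A t)))); rewrite !mulKmx// => /eq_col_mx[].
Qed.

End FanningFrame.

Theorem theorem1p5 (R : realType) (n : nat) (A : R -> 'M[R]_(n + n, n))
    (hA : fanning_frame A) :
  (forall t : R, jacobi_endo A t *m A t = 2^-1 *: (A t *m schwarzian A t)) /\
  (forall S : R -> 'M[R]_n,
     (forall t : R, jacobi_endo A t *m A t = 2^-1 *: (A t *m S t)) ->
     forall t : R, S t = schwarzian A t).
Proof.
split=> [t|S KS t]; first exact: (jacobi_endo_frame A hA t).
apply: (frame_mulmx_inj A hA t).
(* Both products with [A] equal [2 K A], once the nonzero factor [2^-1] is cancelled. *)
have := KS t; rewrite (jacobi_endo_frame A hA t) => /scalerI E; apply/esym/E.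
by rewrite invr_eq0 pnatr_eq0.
Qed.
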